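(* Let $n\in\mathbb{N}$, let $E\subset\mathbb{R}^n$ be an arbitrary set, and let $V$ be a Banach space. Let $\omega:(0,\infty)\to(0,\infty)$ be a non-decreasing function with $\lim_{t\to 0}\omega(t)=0$ for which there is a constant $C_\omega>0$ such that $\frac{s}{\omega(s)}\le C_\omega\frac{t}{\omega(t)}$ whenever $0<s\le t<\infty$. Let $f\in\dot{C}^{0,\omega}(E,V)$. Then the following hold. (1) If $\lim_{t\to0}\frac{t}{\omega(t)}=0$, then $f$ admits an extension $F\in\dot{\mathrm{VC}}^{0,\omega}_{\mathrm{small}}(\mathbb{R}^n,V)$ if and only if $f\in\dot{\mathrm{VC}}^{0,\omega}_{\mathrm{small}}(E,V)$. (2) If $\lim_{t\to\infty}\omega(t)=\infty$ and $\Gamma\in\{\mathrm{large},\mathrm{far}\}$, then $f$ admits an extension $F\in\dot{\mathrm{VC}}^{0,\omega}_{\Gamma}(\mathbb{R}^n,V)$ if and only if $f\in\dot{\mathrm{VC}}^{0,\omega}_{\Gamma}(E,V)$. (3) If both $\lim_{t\to0}\frac{t}{\omega(t)}=0$ and $\lim_{t\to\infty}\omega(t)=\infty$, then $f$ admits an extension $F\in\dot{\mathrm{VC}}^{0,\omega}(\mathbb{R}^n,V)$ if and only if $f\in\dot{\mathrm{VC}}^{0,\omega}(E,V)$.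
   Context: For a set $E\subset\mathbb{R}^n$ (including $E=\mathbb{R}^n$) and a normed space $V$, $\dot{C}^{0,\omega}(E,V)$ is the space of functions $f:E\to V$ with $\|f\|_{\dot{C}^{0,\omega}(E,V)}:=\sup_{x\ne y\in E}\frac{\|f(x)-f(y)\|}{\omega(|x-y|)}<\infty$. Each of the following is the set of $f\in\dot{C}^{0,\omega}(E,V)$ such that (suprema over empty sets are $0$): - $\dot{\mathrm{VC}}^{0,\omega}_{\mathrm{small}}(E,V)$: $\lim_{\delta\to0}\sup_{x\neq y\in E,\ |x-y|\le\delta}\frac{\|f(x)-f(y)\|}{\omega(|x-y|)}=0$; - $\dot{\mathrm{VC}}^{0,\omega}_{\mathrm{large}}(E,V)$: $\lim_{\delta\to\infty}\sup_{x\neq y\in E,\ |x-y|\ge\delta}\frac{\|f(x)-f(y)\|}{\omega(|x-y|)}=0$; - $\dot{\mathrm{VC}}^{0,\omega}_{\mathrm{far}}(E,V)$: $\lim_{\delta\to\infty}\sup_{x\neq y\in E,\ \min(|x|,|y|)\ge\delta}\frac{\|f(x)-f(y)\|}{\omega(|x-y|)}=0$. $\dot{\mathrm{VC}}^{0,\omega}(E,V)$ is the intersection of these three. An extension of $f$ is a function $F:\mathbb{R}^n\to V$ with $F|_E=f$. *)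

(* Defs.v *)
From HB Require Import structures.
From mathcomp Require Import all_boot all_order all_algebra.
From mathcomp Require Import all_classical all_reals all_analysis.

Set Implicit Arguments.
Unset Strict Implicit.
Unset Printing Implicit Defensive.

Import Order.TTheory GRing.Theory Num.Theory.
Import numFieldNormedType.Exports.

Local Open Scope classical_set_scope.
Local Open Scope ring_scope.

(* The Euclidean norm on R^n; the library norm on 'rV[R]_n is the max norm. *)
Definition enorm (R : realType) (n : nat) (x : 'rV[R]_n) : R :=
  Num.sqrt (\sum_(i < n) x 0 i ^+ 2).

Section VanishingHolder.
Context {R : realType} {n : nat} {V : normedModType R}.
Implicit Types (omega : R -> R) (E : set 'rV[R]_n) (f F : 'rV[R]_n -> V).

(* A function E -> V is represented by a total function, of which only the
   values on E are used below.  Likewise only the values omega t, 0 < t, of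
   the modulus are used. *)

(* sup of |f x - f y| / omega |x - y| over the pairs x != y in E satisfying P.
   The quotients are nonnegative for a positive omega, so that the join with 0
   only has the effect that the supremum over the empty set is 0. *)
Definition holder_sup omega E (P : 'rV[R]_n -> 'rV[R]_n -> Prop) f : \bar R :=
  maxe 0%E (ereal_sup
    [set q | exists x y, [/\ E x, E y, x != y, P x y &
                             q = (`|f x - f y| / omega (enorm (x - y)))%:E]]).

Definition holder_seminorm omega E f : \bar R :=
  holder_sup omega E (fun _ _ => True) f.

Definition Cdot omega E : set ('rV[R]_n -> V) :=
  [set f | (holder_seminorm omega E f < +oo)%E].

Definition VC_small omega E : set ('rV[R]_n -> V) :=
  [set f | Cdot omega E f /\
    holder_sup omega E (fun x y => enorm (x - y) <= delta) f
      @[delta --> (0 : R)^'+] --> 0%E].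

Definition VC_large omega E : set ('rV[R]_n -> V) :=
  [set f | Cdot omega E f /\
    holder_sup omega E (fun x y => delta <= enorm (x - y)) f
      @[delta --> +oo] --> 0%E].

Definition VC_far omega E : set ('rV[R]_n -> V) :=
  [set f | Cdot omega E f /\
    holder_sup omega E (fun x y => delta <= Num.min (enorm x) (enorm y)) f
      @[delta --> +oo] --> 0%E].

Definition VC omega E : set ('rV[R]_n -> V) :=
  VC_small omega E `&` VC_large omega E `&` VC_far omega E.

Definition extension E f F : Prop := forall x, E x -> F x = f x.

End VanishingHolder.

(* Main.v *)
Require Import Defs.
From HB Require Import structures.
From mathcomp Require Import all_boot all_order all_algebra.
From mathcomp Require Import all_classical all_reals all_analysis.
From mathcomp Require Import ring lra.

Set Implicit Arguments.
Unset Strict Implicit.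
Unset Printing Implicit Defensive.

Import Order.TTheory GRing.Theory Num.Theory.
Import numFieldNormedType.Exports.

Local Open Scope classical_set_scope.
Local Open Scope ring_scope.

(* One extension F serves all parts.  Sample f at a nearly nearest point of E
   (a limit value at points of the closure of E), giving a total function g;
   then F(x) is the multilinear interpolation of g on a grid whose mesh is
   comparable to the distance d(x) from x to E.  If s = |x - y| and
   D = max(s, d(x)), then
     |F(x) - F(y)| <= C (s / D) osc(f; E /\ B(x, C D)).
   As (s / D) omega(D) <= C_omega omega(s), any bound a * omega(D) for the
   oscillation of f on that ball gives |F(x) - F(y)| <= C C_omega a omega(s).
   With a = const this is the Hoelder bound.  For small a: in the "small" case
   either D is small, or s / D is linear in s, hence o(omega(s)); in the "large"
   case D >= s, so that pairs of E at bounded distance contribute o(omega(D));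
   in the "far" case a ball meeting a fixed ball around 0 has large D, and then
   the points of E near 0 also contribute o(omega(D)).
   The construction uses the max norm of the library, which enters the moduli
   only up to constants. *)

(** * Interpolation on the line and on grids *)

Lemma mx_entry_le (R : realType) m n (x : 'M[R]_(m, n)) i j :
  `|x i j| <= `|x|.
Proof.
rewrite [leRHS]/Num.norm /= mx_normrE.
by apply/bigmax_geP; right => /=; exists (i, j).
Qed.

Lemma mx_norm_le (R : realType) m n (x : 'M[R]_(m, n)) (M : R) :
  0 <= M -> (forall i j, `|x i j| <= M) -> `|x| <= M.
Proof.
move=> M0 xM; rewrite [leLHS]/Num.norm /= mx_normrE.
by apply/bigmax_leP; split => // -[i j] _ /=; exact: xM.
Qed.

Section LinearInterpolation.
Context {R : realType} {V : normedModType R}.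
Implicit Types (u v : int -> V) (t : R).

(** Serves both for the coordinates of a grid and for the logarithm of its mesh. *)
Definition interp u t : V :=
  let m := Num.floor t in
  (1 - (t - m%:~R)) *: u m + (t - m%:~R) *: u (m + 1).

Lemma frac_bounds t : 0 <= t - (Num.floor t)%:~R <= 1.
Proof.
by have /andP[h1 h2] := floor_itv t; move: h2; rewrite intrD; lra.
Qed.

Lemma eq_interp u v t :
  (forall m : int, `|m%:~R - t| <= 1 -> u m = v m) -> interp u t = interp v t.
Proof.
move=> uv; have /andP[h1 h2] := frac_bounds t.
rewrite /interp !uv // ler_norml ?intrD; apply/andP; split; lra.
Qed.

Lemma interpB u v t :
  interp u t - interp v t = interp (fun m => u m - v m) t.
Proof. by rewrite /interp /= !scalerBr [RHS]addrACA -opprD. Qed.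

Lemma interp_cst c t : interp (fun=> c) t = c.
Proof. by rewrite /interp -scalerDl subrK scale1r. Qed.

Lemma norm_interp_le u t (M : R) :
  (forall m : int, `|m%:~R - t| <= 1 -> `|u m| <= M) -> `|interp u t| <= M.
Proof.
move=> uM; have /andP[h1 h2] := frac_bounds t.
have := ler_normD ((1 - (t - (Num.floor t)%:~R)) *: u (Num.floor t))
  ((t - (Num.floor t)%:~R) *: u (Num.floor t + 1)).
rewrite !normrZ (ger0_norm h1) ger0_norm ?subr_ge0// => /le_trans; apply.
have : `|u (Num.floor t)| <= M.
  by apply: uM; rewrite ler_norml; apply/andP; split; lra.
have : `|u (Num.floor t + 1)| <= M.
  by apply: uM; rewrite intrD ler_norml; apply/andP; split; lra.
by nra.
Qed.

Lemma interp_osc u v (t t' M : R) :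
  (forall m m', `|u m - v m'| <= M) -> `|interp u t - interp v t'| <= M.
Proof.
move=> uvM; rewrite -{1}(interp_cst (interp v t') t) interpB.
apply: norm_interp_le => m _.
rewrite -{1}(interp_cst (u m) t') interpB.
by apply: norm_interp_le => m' _; exact: uvM.
Qed.

Lemma interp_floor u t :
  interp u t - u (Num.floor t) =
  (t - (Num.floor t)%:~R) *: (u (Num.floor t + 1) - u (Num.floor t)).
Proof.
by rewrite /interp scalerBl scale1r scalerBr -(addrA (u _)) [LHS]addrC addKr addrC.
Qed.

Lemma interp_floor_next u t :
  u (Num.floor t + 1) - interp u t =
  (1 - (t - (Num.floor t)%:~R)) *: (u (Num.floor t + 1) - u (Num.floor t)).
Proof.
by rewrite [in RHS]scalerBl scale1r -interp_floor opprB addrA subrK.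
Qed.

(** Each unit cell has slope at most [M]. Points at distance at least 1 are covered by the
    oscillation bound; closer ones lie in the same cell or in adjacent cells. *)
Lemma interp_lipschitz u (M : R) :
  (forall m m', `|u m - u m'| <= M) ->
  forall t t', `|interp u t - interp u t'| <= `|t - t'| * M.
Proof.
move=> uM t t'; wlog tt' : t t' / t <= t'.
  move=> H; have [/H//|/ltW/H] := leP t t'.
  by rewrite distrC (distrC t').
have M0 : 0 <= M by rewrite (le_trans _ (uM 0 0)).
have [far|near] := leP 1 `|t - t'|.
  by apply: le_trans (interp_osc _ _ uM) _; rewrite ler_peMl.
move: near; rewrite distrC (ger0_norm (_ : 0 <= t' - t)) ?subr_ge0//.
rewrite (distrC (interp u t)) => near.
have /andP[f1 f2] := frac_bounds t; have /andP[f1' f2'] := frac_bounds t'.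
have /andP[h1 h2] := floor_itv t; have /andP[h1' h2'] := floor_itv t'.
have [le1 le2] : Num.floor t <= Num.floor t' /\ Num.floor t' <= Num.floor t + 1.
  split; first exact: le_floor.
  by rewrite -ltzD1 -(ltr_int R); move: h2 h2'; rewrite !intrD; lra.
have [e|ne] := eqVneq (Num.floor t') (Num.floor t).
  have -> : interp u t' - interp u t =
      (t' - t) *: (u (Num.floor t + 1) - u (Num.floor t)).
    rewrite -(subrKA (u (Num.floor t))) -{1}e interp_floor e.
    rewrite -(opprB (interp u t)) interp_floor -scalerBl.
    by congr (_ *: _); ring.
  by rewrite normrZ (ger0_norm (_ : 0 <= t' - t)) ?subr_ge0// ler_wpM2l ?subr_ge0.
have e : Num.floor t' = Num.floor t + 1.
  by apply/eqP; rewrite eq_le le2 lezD1 lt_neqAle eq_sym ne.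
(* Adjacent cells: pass through the common node [Num.floor t']. *)
rewrite -(subrKA (u (Num.floor t'))) interp_floor e interp_floor_next -e.
apply: le_trans (ler_normD _ _) _; rewrite !normrZ (ger0_norm f1').
rewrite ger0_norm ?subr_ge0//.
have := uM (Num.floor t' + 1) (Num.floor t').
have := uM (Num.floor t') (Num.floor t).
have : t' - t = (t' - (Num.floor t')%:~R) + (1 - (t - (Num.floor t)%:~R)).
  by rewrite e intrD; ring.
by move=> ->; nra.
Qed.

End LinearInterpolation.

Section GridInterpolation.
Context {R : realType} {n : nat} {V : normedModType R}.
Implicit Types (x y z : 'rV[R]_n) (g : 'rV[R]_n -> V) (i j : 'I_n) (h M : R).

Definition set_coord x i (a : R) : 'rV[R]_n :=
  \row_j (if j == i then a else x 0 j).

Definition interp_coord h i g x : V :=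
  interp (fun m => g (set_coord x i (h * m%:~R))) (x 0 i / h).

(** With all coordinates in [s] this is the multilinear interpolant on the grid of mesh [h]; a
    general list permits induction on the coordinates. *)
Definition interp_coords h g (s : seq 'I_n) := foldr (interp_coord h) g s.

Definition grid_interp h g := interp_coords h g (enum 'I_n).

(** Interpolating in coordinate [i] moves it to a node at distance at most [h]; as [s] has no
    repetition, it is not moved again. *)
Lemma eq_interp_coords h g g' s x : uniq s -> 0 < h ->
  (forall z, (forall j, j \notin s -> z 0 j = x 0 j) ->
             (forall j, `|z 0 j - x 0 j| <= h) -> g z = g' z) ->
  interp_coords h g s x = interp_coords h g' s x.
Proof.
elim: s x => [|i s IH] x /=.
  by move=> _ h0; apply=> // j; rewrite subrr normr0 ltW.
move=> /andP[i_s us] h0 gg'; apply: eq_interp => m mx; apply: IH => // z zs zh.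
apply: gg' => j.
  by rewrite inE negb_or => /andP[ji js]; rewrite zs// mxE (negbTE ji).
have [->|ji] := eqVneq j i; last by have := zh j; rewrite mxE (negbTE ji).
rewrite zs ?i_s// mxE eqxx -(ler_pM2l (x := h^-1)) ?invr_gt0// mulVf ?gt_eqF//.
by rewrite -[X in X * _]gtr0_norm ?invr_gt0// -normrM mulrBr mulKf ?gt_eqF// mulrC.
Qed.

Lemma interp_coords_near h g s x c M :
  (forall z, `|g z - c| <= M) -> `|interp_coords h g s x - c| <= M.
Proof.
move=> gM; elim: s x => [|i s IH] x //=.
by rewrite -(interp_cst c 0); apply: interp_osc => m _; exact: IH.
Qed.

(** Each interpolant is a mean of values of its function. Meshes and lists may differ, so that
    values at different scales are comparable; the list [[::]] gives the function itself. *)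
Lemma interp_coords_osc h h' g g' s s' x x' M :
  (forall z z', `|g z - g' z'| <= M) ->
  `|interp_coords h g s x - interp_coords h' g' s' x'| <= M.
Proof.
move=> ggM; apply: interp_coords_near => z.
by rewrite distrC; apply: interp_coords_near => z'; rewrite distrC.
Qed.

(** Change the coordinates one by one: moving coordinate [i] costs [|x_i - y_i| / h * M], and once
    it sits at a common node the points differ only along the rest of the list. *)
Lemma interp_coords_lipschitz h g s x y M : 0 < h ->
  (forall z z', `|g z - g z'| <= M) ->
  (forall j, j \notin s -> x 0 j = y 0 j) ->
  `|interp_coords h g s x - interp_coords h g s y| <=
    (\sum_(j <- s) `|x 0 j - y 0 j|) / h * M.
Proof.
move=> h0 gM; have M0 : 0 <= M by rewrite (le_trans _ (gM 0 0)).
elim: s x y => [|i s IH] x y xy /=.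
  rewrite big_nil !mul0r (_ : x = y) ?subrr ?normr0//.
  by apply/rowP => j; rewrite xy.
rewrite big_cons mulrDl mulrDl.
set u := fun m : int => interp_coords h g s (set_coord x i (h * m%:~R)).
set v := fun m : int => interp_coords h g s (set_coord y i (h * m%:~R)).
rewrite -[X in `|X|](subrKA (interp u (y 0 i / h))).
apply: le_trans (ler_normD _ _) _; apply: lerD.
  apply: le_trans (interp_lipschitz (M := M) _ _ _) _.
    by move=> m m'; exact: interp_coords_osc.
  by rewrite -mulrBl normrM (gtr0_norm (_ : 0 < h^-1)) ?invr_gt0.
rewrite interpB; apply: norm_interp_le => m _.
apply: le_trans (IH _ _ _) _ => [j js|].
  by rewrite !mxE; case: eqVneq => // ji; rewrite xy// inE negb_or ji.
rewrite ler_wpM2r// ler_wpM2r ?invr_ge0 ?(ltW h0)//.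
by apply: ler_sum => j _; rewrite !mxE; case: eqP; rewrite ?subrr ?normr0.
Qed.

Lemma eq_grid_interp h g g' x : 0 < h ->
  (forall z, `|z - x| <= h -> g z = g' z) ->
  grid_interp h g x = grid_interp h g' x.
Proof.
move=> h0 gg'; apply: eq_interp_coords => //; first exact: enum_uniq.
move=> z _ zh; apply: gg'; apply: mx_norm_le; first exact: ltW.
by move=> i j; rewrite !mxE ord1.
Qed.

Lemma grid_interp_lipschitz h g x y M : 0 < h ->
  (forall z z', `|g z - g z'| <= M) ->
  `|grid_interp h g x - grid_interp h g y| <= n%:R * `|x - y| / h * M.
Proof.
move=> h0 gM; have M0 : 0 <= M by rewrite (le_trans _ (gM 0 0)).
apply: le_trans (interp_coords_lipschitz h0 gM _) _.
  by move=> j; rewrite mem_enum.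
rewrite ler_wpM2r// ler_wpM2r ?invr_ge0 ?(ltW h0)// big_enum /=.
rewrite mulr_natl -[X in _ *+ X]card_ord -sumr_const.
by apply: ler_sum => j _; have := mx_entry_le (x - y) 0 j; rewrite !mxE.
Qed.

End GridInterpolation.

(** * Interpolation at a variable scale *)

Lemma expR1_le4 (R : realType) : expR 1 <= 4 :> R.
Proof.
have : expR (2^-1 : R) * expR (- 2^-1) = 1 by rewrite expRN divff// gt_eqF// expR_gt0.
(* The bound [1 + u <= expR u] at [u = -1/2] gives [expR (1/2) <= 2]. *)
have : 2^-1 <= expR (- 2^-1) :> R by apply: le_trans (expR_ge1Dx _); lra.
have -> : expR 1 = expR 2^-1 * expR 2^-1 :> R by rewrite -expRD; congr expR; lra.
by have := expR_gt0 (2^-1 : R); nra.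
Qed.

(** For [b <= a] this is [ln (1 + u) <= u] at [u = a / b - 1]. It controls the change of the
    logarithmic scale. *)
Lemma dist_ln_le (R : realType) (a b c : R) : 0 < c -> c <= a -> c <= b ->
  `|ln a - ln b| <= `|a - b| / c.
Proof.
wlog ba : a b / b <= a.
  move=> H; have [/H//|/ltW/H h] := leP b a.
  by rewrite distrC (distrC a) => c0 ca cb; exact: h.
move=> c0 ca cb; have b0 := lt_le_trans c0 cb; have a0 := lt_le_trans c0 ca.
rewrite !ger0_norm ?subr_ge0 ?ler_ln ?posrE//.
rewrite -ln_div ?posrE//.
have {1}-> : a / b = 1 + (a / b - 1) by rewrite addrC subrK.
apply: le_trans (le_ln1Dx _) _.
  by rewrite -subr_gt0 opprK subrK divr_gt0.
rewrite -[X in _ - X](divff (_ : b != 0)) ?gt_eqF// -mulrBl.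
by rewrite ler_wpM2l ?subr_ge0// lef_pV2 ?posrE.
Qed.

Section WhitneyInterpolation.
Context {R : realType} {n : nat} {V : normedModType R} (d : 'rV[R]_n -> R).
Context (d_ge0 : forall x, 0 <= d x).
Context (d_lipschitz : forall x y, d y <= d x + `|x - y|).
Implicit Types (x y z : 'rV[R]_n) (g : 'rV[R]_n -> V).

(* Grid interpolation at a scale comparable to [d x]; the scale varies
   continuously, by interpolation between the scales [expR k]. *)
Definition whitney_interp g x : V :=
  if d x == 0 then g x
  else interp (fun k => grid_interp (expR k%:~R) g x) (ln (d x)).

(** The nodes [k] used at [x] are within 1 of [ln (d x)], so [expR k] and [d x] differ by a factor
    of at most [expR 1 <= 4]. *)
Lemma scale_bounds x (k : int) : 0 < d x -> `|k%:~R - ln (d x)| <= 1 ->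
  d x / 4 <= expR k%:~R <= 4 * d x.
Proof.
move=> dx0; rewrite ler_norml => /andP[k1 k2].
have e4 := @expR1_le4 R.
have l1 : expR k%:~R <= expR (1 + ln (d x)) by rewrite ler_expR; lra.
have l2 : expR (ln (d x)) <= expR (1 + k%:~R) by rewrite ler_expR; lra.
move: l1 l2; rewrite !expRD lnK ?posrE// => l1 l2.
have e0 := expR_gt0 (k%:~R : R).
by apply/andP; split; nra.
Qed.

Lemma eq_whitney_interp g g' x :
  (forall z, `|z - x| <= 4 * d x -> g z = g' z) ->
  whitney_interp g x = whitney_interp g' x.
Proof.
move=> gg'; rewrite /whitney_interp; case: eqP => [dx0|/eqP dx0].
  by apply: gg'; rewrite subrr normr0 mulr_ge0.
have {}dx0 : 0 < d x by rewrite lt0r dx0 d_ge0.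
apply: eq_interp => k /(scale_bounds dx0) /andP[_ k4].
apply: eq_grid_interp; first exact: expR_gt0.
by move=> z zx; apply: gg'; exact: le_trans zx k4.
Qed.

Lemma whitney_interp_osc g g' x x' (M : R) :
  (forall z z', `|g z - g' z'| <= M) ->
  `|whitney_interp g x - whitney_interp g' x'| <= M.
Proof.
move=> ggM; rewrite /whitney_interp.
case: eqP => _; case: eqP => _ //.
(* A bare value of [g] is viewed as an interpolant that is constant in the scale and has no
   coordinates. *)
- rewrite -[X in X - _](interp_cst _ 0); apply: interp_osc => _ k.
  exact: (interp_coords_osc 1 _ [::]).
- rewrite -[X in _ - X](interp_cst _ 0); apply: interp_osc => k _.
  exact: (interp_coords_osc _ 1 _ [::]).
by apply: interp_osc => k k'; exact: interp_coords_osc.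
Qed.

(** Changing the scale from [ln (d x)] to [ln (d y)] costs [|x - y| / c * M]. At a common mesh,
    which is at least [c / 4], moving the point costs at most [4 * n * |x - y| / c * M]. *)
Lemma whitney_interp_lipschitz g x y (c M : R) :
  0 < c -> c <= d x -> c <= d y -> (forall z z', `|g z - g z'| <= M) ->
  `|whitney_interp g x - whitney_interp g y| <=
    (1 + 4 * n%:R) * (`|x - y| / c) * M.
Proof.
move=> c0 cx cy gM; have M0 : 0 <= M by rewrite (le_trans _ (gM 0 0)).
have dx0 := lt_le_trans c0 cx; have dy0 := lt_le_trans c0 cy.
rewrite /whitney_interp !gt_eqF//.
set u := fun k : int => grid_interp (expR k%:~R) g x.
set v := fun k : int => grid_interp (expR k%:~R) g y.
rewrite -(subrKA (interp u (ln (d y)))).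
rewrite mulrDl mul1r mulrDl.
apply: le_trans (ler_normD _ _) _; apply: lerD.
  apply: le_trans (interp_lipschitz (M := M) _ _ _) _.
    by move=> k k'; exact: interp_coords_osc.
  rewrite ler_wpM2r//; apply: le_trans (dist_ln_le c0 cx cy) _.
  rewrite ler_wpM2r ?invr_ge0 ?(ltW c0)// ler_norml.
  by have := d_lipschitz x y; have := d_lipschitz y x; rewrite (distrC y); lra.
rewrite interpB; apply: norm_interp_le => k /(scale_bounds dy0) /andP[ky _].
apply: le_trans (grid_interp_lipschitz _ _ (expR_gt0 _) gM) _.
rewrite ler_wpM2r// -mulrA (mulrC 4) -!mulrA ler_wpM2l//.
rewrite mulrCA ler_wpM2l// -[4]invrK -invfM lef_pV2 ?posrE ?expR_gt0//; last by lra.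
by lra.
Qed.

(* Only the values of [g] near [x] enter the left-hand side, so [g] may be
   assumed constant elsewhere. *)
Lemma whitney_interp_est g x y (D M : R) : x != y ->
  D = Num.max (d x) `|x - y| ->
  (forall z z', `|z - x| <= 10 * D -> `|z' - x| <= 10 * D ->
     `|g z - g z'| <= M) ->
  `|whitney_interp g x - whitney_interp g y| <=
    (4 + 8 * n%:R) * (`|x - y| / D) * M.
Proof.
move=> xy DE gM.
have s0 : 0 < `|x - y| by rewrite normr_gt0 subr_eq0.
have sD : `|x - y| <= D by rewrite DE le_max lexx orbT.
have dD : d x <= D by rewrite DE le_max lexx.
have D0 := lt_le_trans s0 sD.
pose g' z := if `|z - x| <= 10 * D then g z else g x.
have g'M z z' : `|g' z - g' z'| <= M.
  by rewrite /g'; case: ifP => zx; case: ifP => z'x; apply: gM;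
     rewrite // subrr normr0; lra.
have M0 : 0 <= M by rewrite (le_trans _ (g'M 0 0)).
(* Since [d y <= 2 * D], the data used at [y] lie within [8 * D] of [y], hence within [9 * D] of
   [x]. *)
have dyx := d_lipschitz x y.
have -> : whitney_interp g x = whitney_interp g' x.
  apply: eq_whitney_interp => z zx; rewrite /g' ifT//.
  by apply: le_trans zx _; lra.
have -> : whitney_interp g y = whitney_interp g' y.
  apply: eq_whitney_interp => z zy; rewrite /g' ifT//.
  have := ler_distD y z x; rewrite (distrC y) => /le_trans; apply.
  by move: zy; lra.
(* In the first case [d x] and [d y] are at least [D / 2], and the Lipschitz bound applies. In the
   second, [|x - y| / D >= 1/2] and the oscillation bound suffices. *)
have [near|far] := leP (2 * `|x - y|) (d x).
  have DE' : D = d x by rewrite DE; apply/max_idPl; lra.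
  have c0 : 0 < D / 2 by lra.
  have dxy := d_lipschitz y x; rewrite distrC in dxy.
  apply: le_trans (whitney_interp_lipschitz c0 _ _ g'M) _; [lra|lra|].
  rewrite ler_wpM2r// (_ : `|x - y| / (D / 2) = 2 * (`|x - y| / D)); last first.
    by field; rewrite gt_eqF.
  have : 0 <= `|x - y| / D by rewrite divr_ge0// ltW.
  by move: (`|x - y| / D) (ler0n R n) => r n0 r0; nra.
apply: le_trans (whitney_interp_osc _ _ g'M) _.
rewrite ler_peMl//.
have : 2^-1 <= `|x - y| / D.
  by rewrite ler_pdivlMr// DE maxEle; case: ifP => _; lra.
by move: (`|x - y| / D) (ler0n R n) => r n0 r0; nra.
Qed.

End WhitneyInterpolation.

(** * Extension with oscillation control *)

Section Extension.
Context {R : realType} {n : nat}.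
Implicit Types (E : set 'rV[R]_n) (x y z p q : 'rV[R]_n).

Definition set_dist E x : R := inf [set `|x - p| | p in E].

Lemma set_dist_has_inf E x : E !=set0 -> has_inf [set `|x - p| | p in E].
Proof.
by move=> [p Ep]; split; [exists `|x - p|, p|exists 0 => _ [q _ <-]].
Qed.

Lemma set_dist_ge0 E x : E !=set0 -> 0 <= set_dist E x.
Proof.
move=> /(set_dist_has_inf x)[E0 _]; apply: lb_le_inf => //.
by move=> _ [p _ <-].
Qed.

Lemma set_dist_le E x p : E p -> set_dist E x <= `|x - p|.
Proof.
move=> Ep; have [_ lb] : has_inf [set `|x - p| | p in E].
  by apply: set_dist_has_inf; exists p.
by apply: ge_inf => //; exists p.
Qed.

Lemma set_dist_adherent E x (e : R) : E !=set0 -> 0 < e ->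
  exists2 p, E p & `|x - p| < set_dist E x + e.
Proof.
by move=> /(set_dist_has_inf x) Ex e0; have [_ [p Ep <-]] := inf_adherent e0 Ex; exists p.
Qed.

Lemma set_dist_lipschitz E x y : E !=set0 ->
  set_dist E y <= set_dist E x + `|x - y|.
Proof.
move=> E0; apply/ler_addgt0Pr => e e0; have [p Ep xp] := set_dist_adherent x E0 e0.
apply: le_trans (set_dist_le y Ep) _; have := ler_distD x y p.
by rewrite (distrC y x); lra.
Qed.

(** By uniform continuity the values of [f] form a Cauchy filter along the trace on [E] of the
    neighbourhoods of [z]; completeness of [V] gives the limit. *)
Lemma uniform_limit_value (V : completeNormedModType R) E (f : 'rV[R]_n -> V) z :
  (forall e : R, 0 < e -> exists2 dlt : R, 0 < dlt &
     forall p q, E p -> E q -> `|p - q| <= dlt -> `|f p - f q| <= e) ->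
  (forall e : R, 0 < e -> exists2 p, E p & `|z - p| < e) ->
  exists v : V, forall e : R, 0 < e ->
    exists2 p, E p & `|z - p| <= e /\ `|v - f p| <= e.
Proof.
move=> fE zE; have PF : ProperFilter (within E (nbhs z)).
  apply: within_nbhs_proper => A /nbhs_ballP[e /= e0 eA].
  by have [p Ep zp] := zE e e0; exists p; split => //; apply: eA; rewrite -ball_normE.
have /cauchy_cvg : cauchy (f @ within E (nbhs z)).
  apply/cauchy_exP => e e0; have [dlt d0 fd] := fE (e / 2) ltac:(lra).
  have [p Ep zp] := zE (dlt / 2) ltac:(lra).
  exists (f p); rewrite /fmap/= /within/=; apply/nbhs_ballP.
  exists (dlt / 2) => /=; first by lra.
  move=> q; rewrite -ball_normE /= => zq Eq; rewrite -ball_normE /=.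
  apply: le_lt_trans (fd p q Ep Eq _) _; last by lra.
  have := ler_distD z p q; rewrite (distrC p z); lra.
move=> cf; exists (lim (f @ within E (nbhs z))) => e e0.
have /cvgrPdist_le/(_ e e0) near_f := cf.
have near_z : \forall p \near within E (nbhs z), `|z - p| <= e.
  rewrite near_withinE; apply/nbhs_ballP; exists e => //= p.
  by rewrite -ball_normE /= => /ltW.
have near_E : \forall p \near within E (nbhs z), E p by rewrite near_withinE; near=> p.
have [p [[? ?] ?]] := filter_ex (filterI (filterI near_f near_z) near_E).
by exists p.
Unshelve. all: by end_near. Qed.

(** Three choices of [v]: the value of [f] on [E], a limit on the rest of the closure, and elsewhere
    the value at a point of [E] at distance below [2 * set_dist E z]. The slack [e] accommodates the
    limit. *)
Lemma near_value (V : completeNormedModType R) E (f : 'rV[R]_n -> V) z :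
  E !=set0 ->
  (forall e : R, 0 < e -> exists2 dlt : R, 0 < dlt &
     forall p q, E p -> E q -> `|p - q| <= dlt -> `|f p - f q| <= e) ->
  exists v : V, (E z -> v = f z) /\ forall e : R, 0 < e ->
    exists2 p, E p & `|z - p| <= 2 * set_dist E z + e /\ `|v - f p| <= e.
Proof.
move=> E0 fE; have d0 := set_dist_ge0 z E0.
have [Ez|nEz] := pselect (E z).
  exists (f z); split=> // e e0; exists z; rewrite // !subrr !normr0.
  by split; [lra|exact: ltW].
have [dz|dz] := eqVneq (set_dist E z) 0.
  have [|v vP] := @uniform_limit_value _ E f z fE.
    by move=> e e0; have := set_dist_adherent z E0 e0; rewrite dz add0r.
  by exists v; split=> // e e0; rewrite dz mulr0 add0r; exact: vP.
have {}dz : 0 < set_dist E z by rewrite lt0r dz.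
have [p Ep zp] := set_dist_adherent z E0 dz.
exists (f p); split=> // e e0; exists p; rewrite // subrr normr0.
by split; [lra|exact: ltW].
Qed.

(* The factor [`|x - y| / D] with [`|x - y| <= D] is the slope of an extension
   that is as smooth as the scale [D] (in the construction below, essentially the
   distance from [x] to [E]) permits. *)
Definition osc_controlled (V : normedModType R) E (f F : 'rV[R]_n -> V) (C : R) :=
  forall x y, x != y -> exists2 D : R, `|x - y| <= D & forall M : R, 0 <= M ->
    (forall p q, E p -> E q -> `|p - x| <= C * D -> `|q - x| <= C * D ->
       `|f p - f q| <= M) ->
    `|F x - F y| <= C * (`|x - y| / D) * M.

Theorem whitney_extension (V : completeNormedModType R) E (f : 'rV[R]_n -> V) :
  (forall e : R, 0 < e -> exists2 dlt : R, 0 < dlt &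
     forall p q, E p -> E q -> `|p - q| <= dlt -> `|f p - f q| <= e) ->
  exists F : 'rV[R]_n -> V, extension E f F /\
    exists2 C : R, 1 <= C & osc_controlled E f F C.
Proof.
move=> fE; have [E0|/nonemptyPn E0] := pselect (E !=set0); last first.
  exists (fun=> 0); split; first by move=> x; rewrite E0.
  exists 1 => // x y xy; exists `|x - y| => // M M0 _.
  by rewrite subrr normr0 !mulr_ge0// invr_ge0.
have [g gP] := choice (fun z => near_value z E0 fE).
pose d := set_dist E; have d0 x : 0 <= d x by exact: set_dist_ge0.
have dl x y : d y <= d x + `|x - y| by exact: set_dist_lipschitz.
exists (whitney_interp d g); split.
  move=> x Ex; rewrite /whitney_interp ifT; first exact: (gP x).1.
  by rewrite eq_le d0 andbT; have := set_dist_le x Ex; rewrite subrr normr0.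
have n0 : 0 <= n%:R :> R by [].
(* The slope needs [4 + 8 * n]. A point within [10 * D] of [x] is at distance at most [11 * D] from
   [E], so its sample point is within [(10 + 2 * 11 + 1) * D = 33 * D] of [x]. *)
exists (40 + 8 * n%:R); first by lra.
move=> x y xy; set D := Num.max (d x) `|x - y|.
have s0 : 0 < `|x - y| by rewrite normr_gt0 subr_eq0.
have sD : `|x - y| <= D by rewrite le_max lexx orbT.
have dD : d x <= D by rewrite le_max lexx.
have D0 : 0 < D := lt_le_trans s0 sD.
exists D => // M M0 fM.
apply: le_trans (whitney_interp_est (M := M) d0 dl xy (erefl : D = _) _) _; last first.
  rewrite ler_wpM2r// ler_wpM2r ?divr_ge0 ?(ltW D0)//.
  by lra.
move=> z z' zx z'x; apply/ler_addgt0Pr => e e0.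
(* The bound [e / 2] lets the two sampling errors add up to [e]; the bound [D] keeps the sample
   points in the ball. *)
have e'0 : 0 < Num.min (e / 2) D by rewrite lt_min; apply/andP; split; lra.
have [p Ep [zp gp]] := (gP z).2 _ e'0.
have [p' Ep' [zp' gp']] := (gP z').2 _ e'0.
have [m1 m2] : Num.min (e / 2) D <= e / 2 /\ Num.min (e / 2) D <= D.
  by rewrite !ge_min !lexx orbT.
have near_x w q : `|w - x| <= 10 * D ->
    `|w - q| <= 2 * set_dist E w + Num.min (e / 2) D ->
    `|q - x| <= (40 + 8 * n%:R) * D.
  move=> wx wq; have := dl x w; rewrite (distrC x w).
  have := ler_distD w q x; rewrite (distrC q w) mulrDl.
  have := mulr_ge0 n0 (ltW D0); move: wq dD; rewrite /d; lra.
have := fM p p' Ep Ep' (near_x z p zx zp) (near_x z' p' z'x zp').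
have := ler_distD (f p) (g z) (g z'); have := ler_distD (f p') (f p) (g z').
by rewrite (distrC (f p') (g z')); lra.
Qed.

End Extension.

(** * Vanishing Hoelder conditions *)

Section EuclideanNorm.
Context {R : realType} {n : nat}.
Implicit Types (x y : 'rV[R]_n).

Lemma norm_le_enorm x : `|x| <= enorm x.
Proof.
apply: mx_norm_le => [|i j]; first exact: sqrtr_ge0.
rewrite ord1 -sqrtr_sqr ler_sqrt; last by apply: sumr_ge0 => k _; exact: sqr_ge0.
by rewrite (bigD1 j)//= lerDl sumr_ge0// => k _; exact: sqr_ge0.
Qed.

(** The constant [n + 1], in place of the square root of [n], is at least 1 also for [n = 0], as
    [omega_dilation] requires. *)
Lemma enorm_le_norm x : enorm x <= n.+1%:R * `|x|.
Proof.
rewrite -[leRHS]ger0_norm ?mulr_ge0// -sqrtr_sqr ler_wsqrtr// exprMn.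
apply: (@le_trans _ _ (\sum_(i < n) `|x| ^+ 2)).
  by apply: ler_sum => i _; rewrite -real_normK ?num_real// lerXn2r ?nnegrE// mx_entry_le.
rewrite sumr_const card_ord -[leLHS]mulr_natl ler_wpM2r ?sqr_ge0//.
by rewrite -natrX ler_nat (leq_trans (leqnSn n))// -{1}(expn1 n.+1) leq_pexp2l.
Qed.

Lemma enorm_gt0 x : x != 0 -> 0 < enorm x.
Proof. by move=> x0; apply: lt_le_trans (norm_le_enorm x); rewrite normr_gt0. Qed.

End EuclideanNorm.

Lemma ereal_cvg0P (R : realType) (T : Type) (Phi : set_system T)
    (h : T -> \bar R) : Filter Phi -> (forall t, (0 <= h t)%E) ->
  h @ Phi --> 0%E <->
  forall e : R, 0 < e -> \forall t \near Phi, (h t <= e%:E)%E.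
Proof.
move=> PhiF h0; split=> [/fine_cvgP[hfin /cvgr0Pnorm_le hle] e e0|hle].
  near=> t; have hf : h t \is a fin_num by near: t.
  rewrite -(fineK hf) lee_fin (le_trans (ler_norm _))//.
  by near: t; exact: hle.
apply/fine_cvgP; split.
  apply: filterS (hle 1 ltr01) => t h1; rewrite ge0_fin_numE//.
  by apply: le_lt_trans h1 _; rewrite ltry.
apply/cvgr0Pnorm_le => e e0; apply: filterS (hle e e0) => t he.
rewrite /= ger0_norm ?fine_ge0// -lee_fin fineK// ge0_fin_numE//.
by apply: le_lt_trans he _; rewrite ltry.
Unshelve. all: by end_near. Qed.

(** * The modulus, and the vanishing conditions in the max norm *)

Section Modulus.
Context {R : realType} {n : nat} {V : normedModType R} (omega : R -> R) (C0 : R).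
Context (omega_gt0 : forall t : R, 0 < t -> 0 < omega t).
Context (omega_nd : forall s t : R, 0 < s -> s <= t -> omega s <= omega t).
Context (C0_gt0 : 0 < C0).
Context (omega_C : forall s t : R, 0 < s -> s <= t ->
  s / omega s <= C0 * (t / omega t)).
Implicit Types (E : set 'rV[R]_n) (f : 'rV[R]_n -> V) (x y : 'rV[R]_n).

(** The hypothesis on [s / omega s] read for reciprocals: [omega t / t] is almost decreasing. This
    trades a large scale for the distance of a pair. *)
Lemma omega_slope (s t : R) : 0 < s -> s <= t ->
  omega t / t <= C0 * (omega s / s).
Proof.
move=> s0 st; have t0 := lt_le_trans s0 st.
have := omega_C s0 st; rewrite ler_pdivrMr ?omega_gt0// => h.
rewrite ler_pdivrMr// mulrA mulrAC ler_pdivlMr//.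
rewrite mulrC -ler_pdivlMr ?omega_gt0//; apply: le_trans h _.
by rewrite le_eqVlt; apply/orP; left; apply/eqP; field; rewrite gt_eqF// omega_gt0.
Qed.

Lemma omega_dilation (lam s : R) : 1 <= lam -> 0 < s ->
  omega (lam * s) <= C0 * lam * omega s.
Proof.
move=> l1 s0; have l0 : 0 < lam by lra.
have ls0 : 0 < lam * s by exact: mulr_gt0.
have := omega_slope s0 (ler_peMl (ltW s0) l1).
rewrite ler_pdivrMr// => /le_trans; apply.
by rewrite le_eqVlt; apply/orP; left; apply/eqP; field; rewrite gt_eqF.
Qed.

(** Division-free and in the max norm. It matches a bound on [holder_sup] up to the factor
    [C0 * (n + 1)], which is absorbed whenever [e] is arbitrary. *)
Definition pair_bound E (P : 'rV[R]_n -> 'rV[R]_n -> Prop) f (e : R) :=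
  forall x y, E x -> E y -> x != y -> P x y ->
    `|f x - f y| <= e * omega `|x - y|.

Lemma holder_sup_ge0 E P f : (0 <= holder_sup omega E P f)%E.
Proof. by rewrite /holder_sup le_max lexx. Qed.

Lemma holder_supP E P f (c : R) : 0 <= c ->
  (holder_sup omega E P f <= c%:E)%E <->
  forall x y, E x -> E y -> x != y -> P x y ->
    `|f x - f y| <= c * omega (enorm (x - y)).
Proof.
move=> c0; rewrite /holder_sup ge_max lee_fin c0 /=.
split=> [/ereal_supP h x y Ex Ey xy Pxy|h].
  rewrite -ler_pdivrMr ?omega_gt0 ?enorm_gt0 ?subr_eq0// -lee_fin.
  by apply: h; exists x, y.
apply/ereal_supP => _ [x [y [Ex Ey xy Pxy ->]]].
by rewrite lee_fin ler_pdivrMr ?omega_gt0 ?enorm_gt0 ?subr_eq0//; exact: h.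
Qed.

Lemma omega_enorm x : x != 0 ->
  omega `|x| <= omega (enorm x) <= C0 * n.+1%:R * omega `|x|.
Proof.
move=> x0; have nx0 : 0 < `|x| by rewrite normr_gt0.
rewrite omega_nd ?norm_le_enorm//=.
apply: le_trans (omega_nd (enorm_gt0 x0) (enorm_le_norm x)) _.
by apply: omega_dilation; rewrite // ler1n.
Qed.

Lemma pair_bound_holder_sup E P f (e : R) : 0 <= e ->
  pair_bound E P f e -> (holder_sup omega E P f <= e%:E)%E.
Proof.
move=> e0 fe; apply/holder_supP => // x y Ex Ey xy Pxy.
apply: le_trans (fe x y Ex Ey xy Pxy) _; rewrite ler_wpM2l//.
by have /omega_enorm/andP[] : x - y != 0 by rewrite subr_eq0.
Qed.

Lemma holder_sup_pair_bound E P f (e : R) : 0 <= e ->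
  (holder_sup omega E P f <= e%:E)%E -> pair_bound E P f (e * (C0 * n.+1%:R)).
Proof.
move=> e0 /(holder_supP _ _ _ e0) fe x y Ex Ey xy Pxy.
apply: le_trans (fe x y Ex Ey xy Pxy) _; rewrite -mulrA ler_wpM2l//.
by have /omega_enorm/andP[] : x - y != 0 by rewrite subr_eq0.
Qed.

Lemma CdotP E f :
  Cdot omega E f <-> exists2 L : R, 0 <= L & pair_bound E (fun _ _ => True) f L.
Proof.
rewrite /Cdot /holder_seminorm /=; set h := holder_sup _ _ _ _; split => [hfin|[L L0 fL]].
  have hf : h \is a fin_num by rewrite ge0_fin_numE// holder_sup_ge0.
  have h0 : 0 <= fine h by rewrite fine_ge0// holder_sup_ge0.
  exists (fine h * (C0 * n.+1%:R)); first by rewrite !mulr_ge0// ltW.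
  by apply: holder_sup_pair_bound; rewrite // fineK.
by apply: le_lt_trans (pair_bound_holder_sup L0 fL) _; rewrite ltry.
Qed.

Lemma holder_sup_cvg0P E (P : R -> 'rV[R]_n -> 'rV[R]_n -> Prop) f
    (Phi : set_system R) : Filter Phi ->
  holder_sup omega E (P dlt) f @[dlt --> Phi] --> 0%E <->
  forall e : R, 0 < e -> \forall dlt \near Phi, pair_bound E (P dlt) f e.
Proof.
move=> PhiF; rewrite ereal_cvg0P; last by move=> t; exact: holder_sup_ge0.
have K0 : 0 < C0 * n.+1%:R by rewrite mulr_gt0.
split=> h e e0.
  have e'0 : 0 < e / (C0 * n.+1%:R) by rewrite divr_gt0.
  apply: filterS (h _ e'0) => dlt /(holder_sup_pair_bound (ltW e'0)).
  by rewrite divfK// gt_eqF.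
by apply: filterS (h e e0) => dlt /(pair_bound_holder_sup (ltW e0)).
Qed.

Lemma sub_pair_bound E (P Q : 'rV[R]_n -> 'rV[R]_n -> Prop) f (e : R) :
  (forall x y, Q x y -> P x y) -> pair_bound E P f e -> pair_bound E Q f e.
Proof. by move=> QP fe x y Ex Ey xy /QP; exact: fe. Qed.

(** The condition is monotone in the threshold, so a single [dlt] replaces the limit; changing the
    norm costs at most a factor [n + 1] in [dlt]. The other two conditions are treated alike. *)
Lemma VC_smallP E f : VC_small omega E f <-> Cdot omega E f /\
  forall e : R, 0 < e -> exists2 dlt : R, 0 < dlt &
    pair_bound E (fun x y => `|x - y| <= dlt) f e.
Proof.
rewrite /VC_small /= holder_sup_cvg0P; split=> -[fC h]; split=> // e e0.
  have [dlt /= d0 hd] := h e e0.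
  exists (dlt / 2 / n.+1%:R); first by rewrite !divr_gt0.
  apply: sub_pair_bound (hd (dlt / 2) _ _); last 2 first.
    by rewrite /= sub0r normrN gtr0_norm; lra.
    by lra.
  move=> x y; rewrite ler_pdivlMr// mulrC; apply: le_trans.
  exact: enorm_le_norm.
have [dlt d0 hd] := h e e0; exists dlt => //= t /=; rewrite sub0r normrN => td t0.
apply: sub_pair_bound hd => x y /(le_trans (norm_le_enorm _)) /le_trans; apply.
by move: td; rewrite gtr0_norm// => /ltW.
Qed.

Lemma VC_largeP E f : VC_large omega E f <-> Cdot omega E f /\
  forall e : R, 0 < e -> exists2 dlt : R, 0 < dlt &
    pair_bound E (fun x y => dlt <= `|x - y|) f e.
Proof.
rewrite /VC_large /= holder_sup_cvg0P; split=> -[fC h]; split=> // e e0.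
  have [A [_ hA]] := h e e0.
  exists (`|A| + 1); first by have := normr_ge0 A; lra.
  apply: sub_pair_bound (hA (`|A| + 1) _); last by have := ler_norm A; lra.
  by move=> x y /le_trans; apply; exact: norm_le_enorm.
have [dlt d0 hd] := h e e0; exists (n.+1%:R * dlt); split; first exact: num_real.
move=> t dt; apply: sub_pair_bound hd => x y te.
rewrite -(ler_pM2l (x := n.+1%:R))//.
by apply: le_trans (ltW dt) _; apply: le_trans te _; exact: enorm_le_norm.
Qed.

Lemma VC_farP E f : VC_far omega E f <-> Cdot omega E f /\
  forall e : R, 0 < e -> exists2 dlt : R, 0 < dlt &
    pair_bound E (fun x y => dlt <= `|x| /\ dlt <= `|y|) f e.
Proof.
rewrite /VC_far /= holder_sup_cvg0P; split=> -[fC h]; split=> // e e0.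
  have [A [_ hA]] := h e e0.
  exists (`|A| + 1); first by have := normr_ge0 A; lra.
  apply: sub_pair_bound (hA (`|A| + 1) _); last by have := ler_norm A; lra.
  move=> x y [xA yA]; rewrite le_min (le_trans xA) ?norm_le_enorm//.
  by rewrite (le_trans yA)// norm_le_enorm.
have [dlt d0 hd] := h e e0; exists (n.+1%:R * dlt); split; first exact: num_real.
move=> t dt; apply: sub_pair_bound hd => x y; rewrite le_min => /andP[tx ty].
by split; rewrite -(ler_pM2l (x := n.+1%:R))//;
  apply: le_trans (ltW dt) _; apply: le_trans (enorm_le_norm _).
Qed.

End Modulus.

(** * Vanishing conditions for the extension *)

Section VanishingExtension.
Context {R : realType} {n : nat} {V : normedModType R} (omega : R -> R) (C0 : R).
Context (omega_gt0 : forall t : R, 0 < t -> 0 < omega t).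
Context (omega_nd : forall s t : R, 0 < s -> s <= t -> omega s <= omega t).
Context (C0_gt0 : 0 < C0).
Context (omega_C : forall s t : R, 0 < s -> s <= t ->
  s / omega s <= C0 * (t / omega t)).
Context (E : set 'rV[R]_n) (f F : 'rV[R]_n -> V) (C : R).
Context (C_ge1 : 1 <= C) (F_osc : osc_controlled E f F C).
Implicit Types (x y p q : 'rV[R]_n).


Lemma omega_ball (lam D t : R) : 1 <= lam -> 0 < t -> t <= lam * D ->
  omega t <= C0 * lam * omega D.
Proof.
move=> l1 t0 tD; apply: le_trans (omega_nd t0 tD) _.
apply: omega_dilation => //.
by rewrite -(pmulr_rgt0 _ (lt_le_trans ltr01 l1)); lra.
Qed.

(** Two points of the ball are at distance at most [2 * C * D], and dilation reduces [omega] there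
    to [omega D]. *)
Lemma pair_bound_ball P (e D : R) x p q :
  pair_bound omega E P f e -> 0 <= e -> E p -> E q -> p != q -> P p q ->
  `|p - x| <= C * D -> `|q - x| <= C * D ->
  `|f p - f q| <= e * (C0 * (2 * C)) * omega D.
Proof.
have C1 := C_ge1.
move=> fe e0 Ep Eq pq Ppq px qx; apply: le_trans (fe p q Ep Eq pq Ppq) _.
rewrite -mulrA ler_wpM2l//; apply: omega_ball; first by lra.
  by rewrite normr_gt0 subr_eq0.
have := ler_distD x p q; rewrite (distrC x q); lra.
Qed.

(** Take [M = a * omega D]. The quotient [omega D / D] is isolated because it is almost decreasing
    in [D]. *)
Lemma osc_controlled_slope x y : x != y ->
  exists2 D : R, `|x - y| <= D & forall a : R, 0 <= a ->
    (forall p q, E p -> E q -> p != q ->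
       `|p - x| <= C * D -> `|q - x| <= C * D -> `|f p - f q| <= a * omega D) ->
    `|F x - F y| <= C * a * (omega D / D * `|x - y|).
Proof.
move=> xy; have [D sD FD] := F_osc xy; exists D => // a a0 fa.
have s0 : 0 < `|x - y| by rewrite normr_gt0 subr_eq0.
have D0 := lt_le_trans s0 sD.
have aD : 0 <= a * omega D by rewrite mulr_ge0// ltW// omega_gt0.
apply: le_trans (FD (a * omega D) aD _) _.
  move=> p q Ep Eq px qx; have [->|pq] := eqVneq p q; first by rewrite subrr normr0.
  exact: fa Ep Eq pq px qx.
by rewrite le_eqVlt; apply/orP; left; apply/eqP; field; rewrite gt_eqF.
Qed.

Lemma slope_mul_le (a s D : R) : 0 <= a -> 0 < s -> s <= D ->
  C * a * (omega D / D * s) <= C * C0 * a * omega s.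
Proof.
have C1 := C_ge1; move=> a0 s0 sD.
have -> : C * C0 * a * omega s = C * a * (C0 * (omega s / s) * s).
  by field; rewrite gt_eqF.
rewrite ler_wpM2l ?mulr_ge0//; first by lra.
by rewrite ler_wpM2r ?(ltW s0)//; exact: omega_slope.
Qed.

(** The scale of a pair is known only to be at least [|x - y|], so the oscillation hypothesis ranges
    over all such [D]. *)
Lemma extension_pair_bound (P : 'rV[R]_n -> 'rV[R]_n -> Prop) (a : R) : 0 <= a ->
  (forall x y D p q, P x y -> `|x - y| <= D -> E p -> E q -> p != q ->
     `|p - x| <= C * D -> `|q - x| <= C * D -> `|f p - f q| <= a * omega D) ->
  pair_bound omega setT P F (C * C0 * a).
Proof.
move=> a0 fa x y _ _ xy Pxy; have [D sD FD] := osc_controlled_slope xy.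
apply: le_trans (FD a a0 _) _; first by move=> p q; exact: (fa x y D p q Pxy sD).
by apply: slope_mul_le; rewrite // normr_gt0 subr_eq0.
Qed.

Lemma extension_Cdot : Cdot omega E f -> Cdot omega setT F.
Proof.
have C1 := C_ge1.
rewrite !(CdotP omega_gt0 omega_nd C0_gt0 omega_C) => -[L L0 fL].
exists (C * C0 * (L * (C0 * (2 * C)))); first by rewrite !mulr_ge0// ?(ltW C0_gt0)//; lra.
apply: extension_pair_bound; first by rewrite !mulr_ge0// ?(ltW C0_gt0)//; lra.
by move=> x y D p q _ _ Ep Eq pq; exact: (pair_bound_ball fL).
Qed.

(* At scales [D] bounded below the factor [`|x - y| / D * omega D] is linear in
   [`|x - y|], hence negligible against [omega `|x - y|]. *)
Lemma extension_VC_small : t / omega t @[t --> (0 : R)^'+] --> (0 : R) ->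
  VC_small omega E f -> VC_small omega setT F.
Proof.
have C1 := C_ge1.
move=> om0; rewrite !(VC_smallP omega_gt0 omega_nd C0_gt0 omega_C) => -[fC fs].
split=> [|e e0]; first exact: extension_Cdot.
move: fC; rewrite (CdotP omega_gt0 omega_nd C0_gt0 omega_C) => -[L L0 fL].
have K0 : 0 < C0 * (2 * C) by rewrite mulr_gt0//; lra.
have CC0 : 0 < C * C0 by rewrite mulr_gt0//; lra.
have a0 : 0 < e / (C * C0) / (C0 * (2 * C)) by rewrite !divr_gt0.
have [dlt d0 fd] := fs _ a0.
(* For [D <= D1] two points in a ball of radius [C * D] are at distance at most [dlt]. *)
pose D1 := dlt / (2 * C).
have D1_gt0 : 0 < D1 by rewrite divr_gt0//; lra.
(* Bounds the slope of [F] for pairs of scale [D > D1], where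
   [omega D / D <= C0 * (omega D1 / D1)]. *)
pose B := C * L * (C0 * (2 * C)) * (C0 * (omega D1 / D1)).
have B0 : 0 <= B.
  by rewrite /B !mulr_ge0 ?invr_ge0 ?(ltW C0_gt0) ?(ltW D1_gt0)//;
    rewrite ?(ltW (omega_gt0 _))//; lra.
(* The summand 1 keeps the divisor positive when [B = 0]. *)
have e'0 : 0 < e / (B + 1) by rewrite divr_gt0//; lra.
have /cvgr0Pnorm_le/(_ _ e'0) [r /= r0 hr] := om0.
exists (r / 2); first by lra.
move=> x y _ _ xy xyr; have [D sD FD] := osc_controlled_slope xy.
have s0 : 0 < `|x - y| by rewrite normr_gt0 subr_eq0.
have D0 := lt_le_trans s0 sD.
have [DD1|D1D] := leP D D1.
  have eE : e = C * C0 * (e / (C * C0)) by field; rewrite gt_eqF// gt_eqF//; lra.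
  rewrite eE; apply: le_trans (FD (e / (C * C0)) _ _) (slope_mul_le _ s0 sD).
  - by rewrite divr_ge0// ltW.
  - move=> p q Ep Eq pq px qx.
    rewrite -[X in X * omega D](divfK (_ : C0 * (2 * C) != 0)) ?gt_eqF//.
    apply: (pair_bound_ball fd (ltW a0) Ep Eq pq _ px qx).
    have := ler_distD x p q; rewrite (distrC x q).
    have : D * (2 * C) <= dlt by rewrite -ler_pdivlMr//; lra.
    lra.
  - by rewrite divr_ge0// ltW.
have LK0 : 0 <= L * (C0 * (2 * C)) by rewrite mulr_ge0// ltW.
apply: le_trans (FD _ LK0 _) _.
  by move=> p q Ep Eq pq; exact: (pair_bound_ball fL).
apply: (@le_trans _ _ (B * `|x - y|)).
  have -> : B * `|x - y| = C * (L * (C0 * (2 * C))) *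
      (C0 * (omega D1 / D1) * `|x - y|) by rewrite /B; ring.
  apply: ler_wpM2l; first by rewrite mulr_ge0//; lra.
  by rewrite ler_wpM2r ?(ltW s0)//; exact: omega_slope (ltW D1D).
have := hr `|x - y|; rewrite /= sub0r normrN normr_id => /(_ _ s0).
rewrite ger0_norm ?divr_ge0 ?(ltW (omega_gt0 _))// ler_pdivrMr ?omega_gt0//.
move=> /(_ ltac:(lra)) hs.
apply: (@le_trans _ _ (B * (e / (B + 1) * omega `|x - y|))); first by rewrite ler_wpM2l.
rewrite mulrA ler_wpM2r// ?(ltW (omega_gt0 _))//.
rewrite mulrA ler_pdivrMr; last by lra.
by rewrite mulrC ler_wpM2l// ?ltW//; lra.
Qed.

Lemma omega_eventually_ge (A : R) : omega t @[t --> +oo] --> +oo ->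
  exists2 T : R, 0 < T & forall t, T <= t -> A <= omega t.
Proof.
move=> /cvgryPge/(_ A) [T [_ hT]]; exists (`|T| + 1); first by have := normr_ge0 T; lra.
by move=> t Tt; apply: hT; have := ler_norm T; lra.
Qed.

Lemma extension_VC_large : omega t @[t --> +oo] --> +oo ->
  VC_large omega E f -> VC_large omega setT F.
Proof.
have C1 := C_ge1.
move=> omy; rewrite !(VC_largeP omega_gt0 omega_nd C0_gt0 omega_C) => -[fC fl].
split=> [|e e0]; first exact: extension_Cdot.
move: fC; rewrite (CdotP omega_gt0 omega_nd C0_gt0 omega_C) => -[L L0 fL].
have K0 : 0 < C0 * (2 * C) by rewrite mulr_gt0//; lra.
have CC0 : 0 < C * C0 by rewrite mulr_gt0//; lra.
have a0 : 0 < e / (C * C0) by rewrite divr_gt0.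
have [dlt d0 fd] := fl _ (divr_gt0 a0 K0).
(* From [T <= |x - y| <= D] follows [L * omega dlt <= a * omega D] with [a = e / (C * C0)]; this
   settles pairs of [E] closer than [dlt]. *)
have [T T0 hT] := omega_eventually_ge (L * omega dlt / (e / (C * C0))) omy.
exists T => //.
have -> : e = C * C0 * (e / (C * C0)) by field; rewrite gt_eqF// gt_eqF//; lra.
apply: extension_pair_bound; first exact: ltW.
move=> x y D p q Txy sD Ep Eq pq px qx.
have [far|near] := leP dlt `|p - q|.
  rewrite -[X in X * omega D](divfK (_ : C0 * (2 * C) != 0)) ?gt_eqF//.
  exact: (pair_bound_ball fd (ltW (divr_gt0 a0 K0)) Ep Eq pq far px qx).
apply: le_trans (fL p q Ep Eq pq I) _.
apply: (@le_trans _ _ (L * omega dlt)).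
  by rewrite ler_wpM2l// omega_nd ?(ltW near)// normr_gt0 subr_eq0.
by rewrite [leRHS]mulrC -ler_pdivrMr//; apply: hT; exact: le_trans sD.
Qed.

(* A point [p] of [E] near the origin is compared with a far one through a fixed
   point [p0] of [E] outside the ball of radius [dlt]. *)
Lemma far_near_bound (L dlt e : R) : 0 < dlt -> 0 <= L -> 0 <= e ->
  pair_bound omega E (fun _ _ => True) f L ->
  pair_bound omega E (fun x y => dlt <= `|x| /\ dlt <= `|y|) f e ->
  exists2 K : R, 0 < K & forall p q, E p -> E q -> `|p| < dlt -> dlt <= `|q| ->
    `|f p - f q| <= L * omega K + e * omega (K + `|p - q|).
Proof.
move=> d0 L0 e0 fL fe.
have [[p0 Ep0 p0d]|none] := pselect (exists2 p0, E p0 & dlt <= `|p0|); last first.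
  by exists 1 => // p q Ep Eq _ qd; exfalso; apply: none; exists q.
exists (dlt + `|p0|); first by have := normr_ge0 p0; lra.
move=> p q Ep Eq pd qd.
have pp0 : p != p0 by apply: contraTneq pd => ->; rewrite -leNgt.
have n1 := ler_normB p p0.
apply: le_trans (ler_distD (f p0) _ _) _; apply: lerD.
  apply: le_trans (fL p p0 Ep Ep0 pp0 I) _; rewrite ler_wpM2l// omega_nd//.
    by rewrite normr_gt0 subr_eq0.
  by lra.
have K0 : 0 < dlt + `|p0| + `|p - q|.
  by have := normr_ge0 p0; have := normr_ge0 (p - q); lra.
(* [pair_bound] concerns distinct points only. *)
have [->|p0q] := eqVneq p0 q.
  rewrite subrr normr0 mulr_ge0// ltW// omega_gt0//.
  by have := normr_ge0 q; have := normr_ge0 (p - q); lra.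
apply: le_trans (fe p0 q Ep0 Eq p0q (conj p0d qd)) _.
rewrite ler_wpM2l// omega_nd ?normr_gt0 ?subr_eq0//.
by have := ler_distD p p0 q; rewrite (distrC p0 p); lra.
Qed.

Lemma extension_VC_far : omega t @[t --> +oo] --> +oo ->
  VC_far omega E f -> VC_far omega setT F.
Proof.
have C1 := C_ge1.
move=> omy; rewrite !(VC_farP omega_gt0 omega_nd C0_gt0 omega_C) => -[fC ff].
split=> [|e e0]; first exact: extension_Cdot.
move: fC; rewrite (CdotP omega_gt0 omega_nd C0_gt0 omega_C) => -[L L0 fL].
have K0 : 0 < C0 * (2 * C + 1) by rewrite mulr_gt0//; lra.
have CC0 : 0 < C * C0 by rewrite mulr_gt0//; lra.
pose a := e / (C * C0); have a0 : 0 < a by rewrite divr_gt0.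
(* Each term of [far_near_bound] receives half of [a]; once [K <= D], its argument [K + |p - q|] is
   at most [(2 * C + 1) * D]. *)
pose e' := a / 2 / (C0 * (2 * C + 1)).
have e'0 : 0 < e' by rewrite !divr_gt0.
have e'K : e' * (C0 * (2 * C + 1)) = a / 2 by rewrite /e' divfK// gt_eqF.
have [dlt d0 fd] := ff _ e'0.
have [K Kgt0 fK] := far_near_bound d0 L0 (ltW e'0) fL fd.
have [T1 T10 hT1] := omega_eventually_ge (L * omega (2 * dlt) / a) omy.
have [T2 T20 hT2] := omega_eventually_ge (L * omega K / (a / 2)) omy.
(* Then [T <= D] yields both lower bounds on [omega D] and also [K <= D]. *)
pose T := T1 + T2 + K.
exists (dlt + C * T); first by rewrite addr_gt0// mulr_gt0// /T; lra.
have -> : e = C * C0 * a by rewrite /a; field; rewrite gt_eqF// gt_eqF//; lra.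
apply: extension_pair_bound; first exact: ltW.
move=> x y D p q [xfar _] sD Ep Eq pq px qx.
(* As [|x| >= dlt + C * T], a ball of radius [C * D] around [x] reaches norms below [dlt] only if
   [D] exceeds [T]. *)
have oD z : E z -> `|z| < dlt -> `|z - x| <= C * D -> T <= D.
  move=> Ez zd zx; rewrite -(ler_pM2l (x := C)); last by lra.
  have := ler_distD z x 0; rewrite !subr0 (distrC x); lra.
have mixed r r' : E r -> E r' -> `|r| < dlt -> dlt <= `|r'| ->
    `|r - x| <= C * D -> `|r' - x| <= C * D -> `|f r - f r'| <= a * omega D.
  move=> Er Er' rd r'd rx r'x; have TD := oD r Er rd rx.
  apply: le_trans (fK r r' Er Er' rd r'd) _.
  have -> : a = a / 2 + e' * (C0 * (2 * C + 1)) by rewrite e'K; lra.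
  rewrite mulrDl; apply: lerD.
    by rewrite [leRHS]mulrC -ler_pdivrMr ?divr_gt0//; apply: hT2; rewrite /T in TD; lra.
  rewrite -mulrA ler_wpM2l ?(ltW e'0)//; apply: omega_ball; first by lra.
    by have := normr_ge0 (r - r'); lra.
  have := ler_distD x r r'; rewrite (distrC x r').
  by move: TD; rewrite /T; lra.
have [pd|pd] := ltP `|p| dlt; have [qd|qd] := ltP `|q| dlt.
- have TD := oD p Ep pd px.
  apply: le_trans (fL p q Ep Eq pq I) _.
  apply: (@le_trans _ _ (L * omega (2 * dlt))).
    rewrite ler_wpM2l// omega_nd ?normr_gt0 ?subr_eq0//.
    by have := ler_normB p q; lra.
  by rewrite [leRHS]mulrC -ler_pdivrMr//; apply: hT1; rewrite /T in TD; lra.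
- exact: mixed.
- by rewrite distrC; exact: mixed.
apply: le_trans (fd p q Ep Eq pq (conj pd qd)) _.
have D0 : 0 < D.
  have := normr_ge0 (p - q); rewrite le_eqVlt eq_sym normr_eq0 subr_eq0 (negbTE pq) /=.
  have := ler_distD x p q; rewrite (distrC x q) => h h0.
  by rewrite -(pmulr_rgt0 _ (lt_le_trans ltr01 C1)); lra.
apply: (@le_trans _ _ (e' * (C0 * (2 * C + 1) * omega D))).
  rewrite ler_wpM2l ?(ltW e'0)//; apply: omega_ball; first by lra.
    by rewrite normr_gt0 subr_eq0.
  by have := ler_distD x p q; rewrite (distrC x q); lra.
by rewrite mulrA e'K ler_wpM2r ?(ltW (omega_gt0 _))//; lra.
Qed.

End VanishingExtension.

(** * Uniform continuity, restriction and the equivalences *)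

Lemma Cdot_uniform (R : realType) (n : nat) (V : normedModType R)
    (omega : R -> R) (E : set 'rV[R]_n) (f : 'rV[R]_n -> V) (L : R) :
  omega t @[t --> (0 : R)^'+] --> (0 : R) -> 0 <= L ->
  pair_bound omega E (fun _ _ => True) f L ->
  forall e : R, 0 < e -> exists2 dlt : R, 0 < dlt &
    forall p q, E p -> E q -> `|p - q| <= dlt -> `|f p - f q| <= e.
Proof.
move=> om0 L0 fL e e0; have e'0 : 0 < e / (L + 1) by rewrite divr_gt0//; lra.
have /cvgr0Pnorm_le/(_ _ e'0) [r /= r0 hr] := om0.
exists (r / 2); first by lra.
move=> p q Ep Eq pqr; have [->|pq] := eqVneq p q; first by rewrite subrr normr0 ltW.
have s0 : 0 < `|p - q| by rewrite normr_gt0 subr_eq0.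
apply: le_trans (fL p q Ep Eq pq I) _.
have := hr `|p - q|; rewrite /= sub0r normrN normr_id => /(_ ltac:(lra) s0).
move=> /(le_trans (ler_norm _)); rewrite ler_pdivlMr; last by lra.
(* At a negative value of [omega] the bound [L * omega] is nonpositive, hence below [e]. *)
have [om_ge0|om_lt0] := leP 0 (omega `|p - q|); first by nra.
by have := mulr_ge0_le0 L0 (ltW om_lt0); lra.
Qed.

Lemma extension_pair_bound_restrict (R : realType) (n : nat) (V : normedModType R)
    (omega : R -> R) (E : set 'rV[R]_n) P (f F : 'rV[R]_n -> V) (e : R) :
  extension E f F -> pair_bound omega setT P F e -> pair_bound omega E P f e.
Proof.
by move=> EF Fe x y Ex Ey xy Pxy; rewrite -!EF//; exact: Fe.
Qed.

Theorem corollary1p8 (R : realType) (n : nat) (E : set 'rV[R]_n)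
    (V : completeNormedModType R) (omega : R -> R)
    (omega_gt0 : forall t : R, 0 < t -> 0 < omega t)
    (omega_nd : forall s t : R, 0 < s -> s <= t -> omega s <= omega t)
    (omega_0 : omega t @[t --> (0 : R)^'+] --> (0 : R))
    (omega_C : exists2 C : R, 0 < C &
       forall s t : R, 0 < s -> s <= t -> s / omega s <= C * (t / omega t))
    (f : 'rV[R]_n -> V) (hf : Cdot omega E f) :
  [/\ (t / omega t @[t --> (0 : R)^'+] --> (0 : R) ->
        ((exists F, extension E f F /\ VC_small omega [set: 'rV[R]_n] F)
         <-> VC_small omega E f)),
      (omega t @[t --> +oo] --> +oo ->
        ((exists F, extension E f F /\ VC_large omega [set: 'rV[R]_n] F)
         <-> VC_large omega E f) /\
        ((exists F, extension E f F /\ VC_far omega [set: 'rV[R]_n] F)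
         <-> VC_far omega E f)) &
      (t / omega t @[t --> (0 : R)^'+] --> (0 : R) ->
       omega t @[t --> +oo] --> +oo ->
        ((exists F, extension E f F /\ VC omega [set: 'rV[R]_n] F)
         <-> VC omega E f))].
Proof.
have [C0 C0_gt0 omC] := omega_C.
have [L L0 fL] := (CdotP omega_gt0 omega_nd C0_gt0 omC E f).1 hf.
have [F [EF [C C_ge1 F_osc]]] := whitney_extension (Cdot_uniform omega_0 L0 fL).
(* The forward implications start from an arbitrary extension [G] and restrict its pair bounds to
   [E]. *)
have restr_small G : extension E f G -> VC_small omega setT G -> VC_small omega E f.
  move=> EG /(VC_smallP omega_gt0 omega_nd C0_gt0 omC)[_ hG].
  apply/(VC_smallP omega_gt0 omega_nd C0_gt0 omC); split=> // e /hG[dlt d0 h].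
  by exists dlt => //; exact: extension_pair_bound_restrict h.
have restr_large G : extension E f G -> VC_large omega setT G -> VC_large omega E f.
  move=> EG /(VC_largeP omega_gt0 omega_nd C0_gt0 omC)[_ hG].
  apply/(VC_largeP omega_gt0 omega_nd C0_gt0 omC); split=> // e /hG[dlt d0 h].
  by exists dlt => //; exact: extension_pair_bound_restrict h.
have restr_far G : extension E f G -> VC_far omega setT G -> VC_far omega E f.
  move=> EG /(VC_farP omega_gt0 omega_nd C0_gt0 omC)[_ hG].
  apply/(VC_farP omega_gt0 omega_nd C0_gt0 omC); split=> // e /hG[dlt d0 h].
  by exists dlt => //; exact: extension_pair_bound_restrict h.
have small := extension_VC_small omega_gt0 omega_nd C0_gt0 omC C_ge1 F_osc.
have large := extension_VC_large omega_gt0 omega_nd C0_gt0 omC C_ge1 F_osc.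
have far := extension_VC_far omega_gt0 omega_nd C0_gt0 omC C_ge1 F_osc.
split.
- move=> om0; split=> [[G [EG]]|]; first exact: restr_small.
  by move=> fV; exists F; split=> //; exact: small.
- move=> omy; split; split=> [[G [EG]]|].
  + exact: restr_large.
  + by move=> fV; exists F; split=> //; exact: large.
  + exact: restr_far.
  + by move=> fV; exists F; split=> //; exact: far.
- move=> om0 omy; split=> [[G [EG [[Gs Gl] Gf]]]|[[fs fl] ff]].
    split; first split.
    + exact: restr_small EG Gs.
    + exact: restr_large EG Gl.
    + exact: restr_far EG Gf.
  exists F; split=> //; split; first split; [exact: small|exact: large|exact: far].
Qed.
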